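(* Let $F$ be a field in which $2$ is invertible, and let $(V,B)$ be a formed space over $F$, with Kingdon algebra $K(V,B)$ and insertion $\iota\colon V\to K(V,B);\ v\mapsto I_B+v$. Let $V^\iota$ denote the image of $\iota$, and consider the negation map $\nu\colon V^\iota\to V^\iota;\ I_B+v\mapsto I_B-v$. (a) The Kingdon algebra $K(V,B)$ has a uniquely defined involutory automorphism extending the negation map $\nu$ of $V^\iota$. (b) The Kingdon algebra $K(V,B)$ has a uniquely defined involutory anti-automorphism extending the negation map $\nu$ of $V^\iota$.
   Context: Algebras over $F$ are unital but not necessarily associative; automorphisms and anti-automorphisms are $F$-linear and unital, and are called involutory if their square is the identity. A formed space $(V,B)$ is a finite-dimensional $F$-vector space $V$ with a symmetric bilinear form $B$. An algebra is alternative if $x(xy)=(xx)y$ and $y(xx)=(yx)x$ for all elements $x,y$. $\mathrm{Alt}[V]$ denotes the free (unital) alternative $F$-algebra over $V$: it is alternative, contains $V$ as a subspace and $F=F1$, and each linear map from $V$ to an alternative $F$-algebra extends uniquely to an $F$-algebra homomorphism on $\mathrm{Alt}[V]$. The Kingdon algebra is $K(V,B)=\mathrm{Alt}[V]/I_B$, where $I_B$ is the two-sided ideal generated by all elements $uv+vu-B(u,v)\cdot 1$ and $(uv)w-w(vu)$ with $u,v,w\in V$. *)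

(* Defs.v *)
From HB Require Import structures.
From mathcomp Require Import all_boot all_algebra.
From mathcomp Require Import boolp classical_sets.

Set Implicit Arguments.
Unset Strict Implicit.
Unset Printing Implicit Defensive.

Import GRing.Theory.
Local Open Scope ring_scope.
Local Open Scope quotient_scope.
Local Open Scope classical_set_scope.

(* The zero algebra, in which naone = 0, is allowed. *)
HB.mixin Record Lmodule_isNonassocAlgebra (F : fieldType) A
    of GRing.Lmodule F A := {
  namul : A -> A -> A;
  naone : A;
  namulDl : forall x y z : A, namul (x + y) z = namul x z + namul y z;
  namulDr : forall x y z : A, namul x (y + z) = namul x y + namul x z;
  namulZl : forall (a : F) (x y : A), namul (a *: x) y = a *: namul x y;
  namulZr : forall (a : F) (x y : A), namul x (a *: y) = a *: namul x y;
  namul1l : forall x : A, namul naone x = x;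
  namul1r : forall x : A, namul x naone = x
}.

#[short(type="naAlgType")]
HB.structure Definition NonassocAlgebra (F : fieldType) :=
  {A of Lmodule_isNonassocAlgebra F A & GRing.Lmodule F A}.

Arguments naone {F} s.
Notation "x ** y" := (namul x y) (at level 40, left associativity) : ring_scope.

Definition alternative (F : fieldType) (A : naAlgType F) : Prop :=
  (forall x y : A, x ** (x ** y) = (x ** x) ** y) /\
  (forall x y : A, y ** (x ** x) = (y ** x) ** x).

Definition nalg_hom (F : fieldType) (A C : naAlgType F) (f : A -> C) : Prop :=
  [/\ linear f, f (naone A) = naone C &
      forall x y : A, f (x ** y) = f x ** f y].

Definition nalg_antihom (F : fieldType) (A C : naAlgType F) (f : A -> C) :
  Prop :=
  [/\ linear f, f (naone A) = naone C &
      forall x y : A, f (x ** y) = f y ** f x].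

Definition nalg_automorphism (F : fieldType) (A : naAlgType F) (f : A -> A) :
  Prop := bijective f /\ nalg_hom f.

Definition nalg_antiautomorphism (F : fieldType) (A : naAlgType F)
  (f : A -> A) : Prop := bijective f /\ nalg_antihom f.

Definition is_nalg_ideal (F : fieldType) (A : naAlgType F) (I : set A) :
  Prop :=
  [/\ I 0, forall (a : F) (x y : A), I x -> I y -> I (a *: x + y),
      forall x y : A, I y -> I (x ** y) & forall x y : A, I x -> I (x ** y)].

Record nalg_ideal (F : fieldType) (A : naAlgType F) := NalgIdeal {
  ideal_set :> A -> Prop;
  ideal_setP : is_nalg_ideal ideal_set
}.

Lemma gen_ideal_subproof (F : fieldType) (A : naAlgType F) (S : set A) :
  is_nalg_ideal (smallest (@is_nalg_ideal F A) S).
Proof.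
split=> [J [[] //]|a x y Ix Iy J JS|x y Iy J JS|x y Ix J JS].
- by have [[_ h _ _] _] := JS; apply: h; [apply: Ix|apply: Iy].
- by have [[_ _ h _] _] := JS; apply: h; apply: Iy.
- by have [[_ _ _ h] _] := JS; apply: h; apply: Ix.
Qed.

Definition gen_ideal (F : fieldType) (A : naAlgType F) (S : set A) :
  nalg_ideal A := NalgIdeal (gen_ideal_subproof S).

Section IdealQuotient.
Variables (F : fieldType) (A : naAlgType F) (I : nalg_ideal A).

Definition ideal_pred : {pred A} := fun x => `[< I x >].

Lemma ideal_predP (x : A) : reflect (I x) (x \in ideal_pred).
Proof. exact: asboolP. Qed.

Lemma ideal_pred_zmod_closed : zmod_closed ideal_pred.
Proof.
have [I0 IL _ _] := ideal_setP I.
split; first exact/ideal_predP.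
move=> x y /ideal_predP Ix /ideal_predP Iy; apply/ideal_predP.
by rewrite addrC -scaleN1r; apply: IL.
Qed.

HB.instance Definition _ :=
  GRing.isZmodClosed.Build A ideal_pred ideal_pred_zmod_closed.

Definition ideal_zmod : zmodClosed A := ideal_pred.
Definition naquot : Type := Quotient.quot ideal_zmod.
HB.instance Definition _ := GRing.Zmodule.on naquot.

Definition napi (x : A) : naquot := \pi_(Quotient.quot ideal_zmod) x.
Definition narepr (q : naquot) : A := repr (q : Quotient.quot ideal_zmod).

Lemma nareprK : cancel narepr napi.
Proof. by move=> q; rewrite /napi /narepr reprK. Qed.

Lemma napiP (x y : A) : napi x = napi y <-> I (x - y).
Proof.
split=> [/eqP h|h].
  by apply/ideal_predP; rewrite Quotient.idealrBE.
by apply/eqP; rewrite /napi -Quotient.idealrBE; apply/ideal_predP.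
Qed.

Lemma napiD : {morph napi : x y / x + y}.
Proof. exact: (@Quotient.pi_add A ideal_zmod). Qed.

Lemma napi_narepr (x : A) : I (narepr (napi x) - x).
Proof. by apply/napiP; rewrite nareprK. Qed.

Definition naquot_scale (a : F) (q : naquot) : naquot := napi (a *: narepr q).
Definition naquot_mul (p q : naquot) : naquot := napi (narepr p ** narepr q).

Lemma napi_scale (a : F) (x : A) : naquot_scale a (napi x) = napi (a *: x).
Proof.
have [I0 IL _ _] := ideal_setP I.
apply/napiP; rewrite -scalerBr -[X in I X]addr0.
by apply: IL => //; apply: napi_narepr.
Qed.

Lemma napi_mul (x y : A) : naquot_mul (napi x) (napi y) = napi (x ** y).
Proof.
have [I0 IL Il Ir] := ideal_setP I.
apply/napiP.
set x' := narepr _; set y' := narepr _.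
have -> : x' ** y' - x ** y = 1 *: ((x' - x) ** y') + x ** (y' - y).
  rewrite scale1r namulDl namulDr -!scaleN1r namulZl namulZr !scaleN1r.
  by rewrite addrA subrK.
by apply: IL; [apply: Ir | apply: Il]; apply: napi_narepr.
Qed.

Lemma naquot_scaleA (a b : F) (q : naquot) :
  naquot_scale a (naquot_scale b q) = naquot_scale (a * b) q.
Proof. by rewrite -[q]nareprK !napi_scale scalerA. Qed.

Lemma naquot_scale1 : left_id 1 naquot_scale.
Proof. by move=> q; rewrite -[q]nareprK napi_scale scale1r. Qed.

Lemma naquot_scaleDr : right_distributive naquot_scale +%R.
Proof.
move=> a p q; rewrite -[p]nareprK -[q]nareprK.
by rewrite -napiD !napi_scale scalerDr napiD.
Qed.

Lemma naquot_scaleDl (q : naquot) :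
  {morph naquot_scale^~ q : a b / a + b}.
Proof.
by move=> a b; rewrite -[q]nareprK !napi_scale scalerDl napiD.
Qed.

HB.instance Definition _ := GRing.Zmodule_isLmodule.Build F naquot
  naquot_scaleA naquot_scale1 naquot_scaleDr naquot_scaleDl.

Lemma napiZ (a : F) (x : A) : napi (a *: x) = a *: napi x.
Proof. by rewrite -napi_scale. Qed.

Lemma naquot_mulDl (x y z : naquot) :
  naquot_mul (x + y) z = naquot_mul x z + naquot_mul y z.
Proof.
rewrite -[x]nareprK -[y]nareprK -[z]nareprK.
by rewrite -napiD !napi_mul namulDl napiD.
Qed.

Lemma naquot_mulDr (x y z : naquot) :
  naquot_mul x (y + z) = naquot_mul x y + naquot_mul x z.
Proof.
rewrite -[x]nareprK -[y]nareprK -[z]nareprK.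
by rewrite -napiD !napi_mul namulDr napiD.
Qed.

Lemma naquot_mulZl (a : F) (x y : naquot) :
  naquot_mul (a *: x) y = a *: naquot_mul x y.
Proof.
rewrite -[x]nareprK -[y]nareprK.
by rewrite -napiZ !napi_mul namulZl napiZ.
Qed.

Lemma naquot_mulZr (a : F) (x y : naquot) :
  naquot_mul x (a *: y) = a *: naquot_mul x y.
Proof.
rewrite -[x]nareprK -[y]nareprK.
by rewrite -napiZ !napi_mul namulZr napiZ.
Qed.

Lemma naquot_mul1l (x : naquot) : naquot_mul (napi (naone A)) x = x.
Proof. by rewrite -[x]nareprK napi_mul namul1l. Qed.

Lemma naquot_mul1r (x : naquot) : naquot_mul x (napi (naone A)) = x.
Proof. by rewrite -[x]nareprK napi_mul namul1r. Qed.

HB.instance Definition _ := Lmodule_isNonassocAlgebra.Build F naquot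
  naquot_mulDl naquot_mulDr naquot_mulZl naquot_mulZr
  naquot_mul1l naquot_mul1r.

Lemma napi_hom : nalg_hom napi.
Proof.
split=> [a x y||x y]; [by rewrite napiD napiZ|by []|].
by rewrite -napi_mul.
Qed.

End IdealQuotient.

(* Alt below is the free alternative algebra over V: formal expressions modulo
   the congruence generated by the axioms of unital alternative algebras and
   the linearity of the inclusion of V. See alt_alternative, alt_universal and
   alt_scalar_gen_inj. *)

Section FreeAlternative.
Variables (F : fieldType) (V : lmodType F).

Inductive alt_term : Type :=
| TGen of V
| TOne
| TZero
| TOpp of alt_term
| TAdd of alt_term & alt_term
| TScale of F & alt_term
| TMul of alt_term & alt_term.

Inductive alt_eq : alt_term -> alt_term -> Prop :=
| AErefl t : alt_eq t t
| AEsym s t : alt_eq s t -> alt_eq t s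
| AEtrans s t u : alt_eq s t -> alt_eq t u -> alt_eq s u
| AEopp s t : alt_eq s t -> alt_eq (TOpp s) (TOpp t)
| AEadd s s' t t' : alt_eq s s' -> alt_eq t t' ->
    alt_eq (TAdd s t) (TAdd s' t')
| AEscale a s t : alt_eq s t -> alt_eq (TScale a s) (TScale a t)
| AEmul s s' t t' : alt_eq s s' -> alt_eq t t' ->
    alt_eq (TMul s t) (TMul s' t')
| AEaddA s t u : alt_eq (TAdd s (TAdd t u)) (TAdd (TAdd s t) u)
| AEaddC s t : alt_eq (TAdd s t) (TAdd t s)
| AEadd0 s : alt_eq (TAdd TZero s) s
| AEaddN s : alt_eq (TAdd (TOpp s) s) TZero
| AEscaleA a b s : alt_eq (TScale a (TScale b s)) (TScale (a * b) s)
| AEscale1 s : alt_eq (TScale 1 s) s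
| AEscaleDr a s t :
    alt_eq (TScale a (TAdd s t)) (TAdd (TScale a s) (TScale a t))
| AEscaleDl a b s :
    alt_eq (TScale (a + b) s) (TAdd (TScale a s) (TScale b s))
| AEmulDl s t u : alt_eq (TMul (TAdd s t) u) (TAdd (TMul s u) (TMul t u))
| AEmulDr s t u : alt_eq (TMul s (TAdd t u)) (TAdd (TMul s t) (TMul s u))
| AEmulZl a s t : alt_eq (TMul (TScale a s) t) (TScale a (TMul s t))
| AEmulZr a s t : alt_eq (TMul s (TScale a t)) (TScale a (TMul s t))
| AEmul1l s : alt_eq (TMul TOne s) s
| AEmul1r s : alt_eq (TMul s TOne) s
| AEaltl s t : alt_eq (TMul s (TMul s t)) (TMul (TMul s s) t)
| AEaltr s t : alt_eq (TMul t (TMul s s)) (TMul (TMul t s) s)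
| AEgenD u v : alt_eq (TGen (u + v)) (TAdd (TGen u) (TGen v))
| AEgenZ a u : alt_eq (TGen (a *: u)) (TScale a (TGen u)).

Definition alt_rel (s t : {classic alt_term}) : bool := `[< alt_eq s t >].

Lemma alt_rel_equiv : equiv_class_of alt_rel.
Proof.
split=> [t|s t|t s u].
- exact/asboolP/AErefl.
- by apply/asboolP/asboolP; apply: AEsym.
- move=> /asboolP st /asboolP tu; apply/asboolP; exact: AEtrans st tu.
Qed.

Canonical alt_equiv := EquivRelPack alt_rel_equiv.
Canonical alt_encModRel := defaultEncModRel alt_rel.

Definition Alt : Type := {eq_quot alt_rel}.
HB.instance Definition _ := Choice.on Alt.

Definition alt_pi (t : alt_term) : Alt :=
  \pi_({eq_quot alt_rel}) (t : {classic alt_term}).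
Definition alt_repr (x : Alt) : alt_term := repr (x : {eq_quot alt_rel}).

Lemma alt_reprK : cancel alt_repr alt_pi.
Proof. by move=> x; rewrite /alt_pi /alt_repr reprK. Qed.

Lemma alt_piP (s t : alt_term) : alt_pi s = alt_pi t <-> alt_eq s t.
Proof.
split=> [/eqmodP/asboolP //|h].
exact/eqmodP/asboolP.
Qed.

Lemma alt_repr_pi (t : alt_term) : alt_eq (alt_repr (alt_pi t)) t.
Proof. by apply/alt_piP; rewrite alt_reprK. Qed.

Definition alt_zero : Alt := alt_pi TZero.
Definition alt_opp (x : Alt) : Alt := alt_pi (TOpp (alt_repr x)).
Definition alt_add (x y : Alt) : Alt := alt_pi (TAdd (alt_repr x) (alt_repr y)).
Definition alt_scale (a : F) (x : Alt) : Alt :=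
  alt_pi (TScale a (alt_repr x)).
Definition alt_mul (x y : Alt) : Alt := alt_pi (TMul (alt_repr x) (alt_repr y)).
Definition alt_one : Alt := alt_pi TOne.
Definition alt_in (v : V) : Alt := alt_pi (TGen v).

Lemma alt_pi_opp t : alt_opp (alt_pi t) = alt_pi (TOpp t).
Proof. apply/alt_piP; apply: AEopp; exact: alt_repr_pi. Qed.
Lemma alt_pi_add s t : alt_add (alt_pi s) (alt_pi t) = alt_pi (TAdd s t).
Proof. apply/alt_piP; apply: AEadd; exact: alt_repr_pi. Qed.
Lemma alt_pi_scale a t : alt_scale a (alt_pi t) = alt_pi (TScale a t).
Proof. apply/alt_piP; apply: AEscale; exact: alt_repr_pi. Qed.
Lemma alt_pi_mul s t : alt_mul (alt_pi s) (alt_pi t) = alt_pi (TMul s t).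
Proof. apply/alt_piP; apply: AEmul; exact: alt_repr_pi. Qed.

Definition alt_piE :=
  (alt_pi_opp, alt_pi_add, alt_pi_scale, alt_pi_mul).

Lemma alt_addA : associative alt_add.
Proof.
move=> x y z; rewrite -[x]alt_reprK -[y]alt_reprK -[z]alt_reprK !alt_piE.
apply/alt_piP; exact: AEaddA.
Qed.

Lemma alt_addC : commutative alt_add.
Proof.
move=> x y; rewrite -[x]alt_reprK -[y]alt_reprK !alt_piE.
apply/alt_piP; exact: AEaddC.
Qed.

Lemma alt_add0 : left_id alt_zero alt_add.
Proof.
move=> x; rewrite -[x]alt_reprK !alt_piE; apply/alt_piP; exact: AEadd0.
Qed.

Lemma alt_addN : left_inverse alt_zero alt_opp alt_add.
Proof.
move=> x; rewrite -[x]alt_reprK !alt_piE; apply/alt_piP; exact: AEaddN.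
Qed.

HB.instance Definition _ :=
  GRing.isZmodule.Build Alt alt_addA alt_addC alt_add0 alt_addN.

Lemma alt_scaleA (a b : F) (x : Alt) :
  alt_scale a (alt_scale b x) = alt_scale (a * b) x.
Proof.
rewrite -[x]alt_reprK !alt_piE; apply/alt_piP; exact: AEscaleA.
Qed.

Lemma alt_scale1 : left_id 1 alt_scale.
Proof.
move=> x; rewrite -[x]alt_reprK !alt_piE; apply/alt_piP; exact: AEscale1.
Qed.

Lemma alt_scaleDr : right_distributive alt_scale +%R.
Proof.
move=> a x y; rewrite -[x]alt_reprK -[y]alt_reprK.
rewrite /GRing.add /= !alt_piE; apply/alt_piP; exact: AEscaleDr.
Qed.

Lemma alt_scaleDl (x : Alt) : {morph alt_scale^~ x : a b / a + b}.
Proof.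
move=> a b; rewrite -[x]alt_reprK {2}/GRing.add /= !alt_piE.
apply/alt_piP; exact: AEscaleDl.
Qed.

HB.instance Definition _ := GRing.Zmodule_isLmodule.Build F Alt
  alt_scaleA alt_scale1 alt_scaleDr alt_scaleDl.

Lemma alt_mulDl (x y z : Alt) :
  alt_mul (x + y) z = alt_mul x z + alt_mul y z.
Proof.
rewrite -[x]alt_reprK -[y]alt_reprK -[z]alt_reprK.
rewrite /GRing.add /= !alt_piE; apply/alt_piP; exact: AEmulDl.
Qed.

Lemma alt_mulDr (x y z : Alt) :
  alt_mul x (y + z) = alt_mul x y + alt_mul x z.
Proof.
rewrite -[x]alt_reprK -[y]alt_reprK -[z]alt_reprK.
rewrite /GRing.add /= !alt_piE; apply/alt_piP; exact: AEmulDr.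
Qed.

Lemma alt_mulZl (a : F) (x y : Alt) :
  alt_mul (a *: x) y = a *: alt_mul x y.
Proof.
rewrite -[x]alt_reprK -[y]alt_reprK.
rewrite /GRing.scale /= !alt_piE; apply/alt_piP; exact: AEmulZl.
Qed.

Lemma alt_mulZr (a : F) (x y : Alt) :
  alt_mul x (a *: y) = a *: alt_mul x y.
Proof.
rewrite -[x]alt_reprK -[y]alt_reprK.
rewrite /GRing.scale /= !alt_piE; apply/alt_piP; exact: AEmulZr.
Qed.

Lemma alt_mul1l (x : Alt) : alt_mul alt_one x = x.
Proof.
rewrite -[x]alt_reprK !alt_piE; apply/alt_piP; exact: AEmul1l.
Qed.

Lemma alt_mul1r (x : Alt) : alt_mul x alt_one = x.
Proof.
rewrite -[x]alt_reprK !alt_piE; apply/alt_piP; exact: AEmul1r.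
Qed.

HB.instance Definition _ := Lmodule_isNonassocAlgebra.Build F Alt
  alt_mulDl alt_mulDr alt_mulZl alt_mulZr alt_mul1l alt_mul1r.

Lemma alt_alternative : alternative Alt.
Proof.
split=> x y; rewrite -[x]alt_reprK -[y]alt_reprK /namul /= !alt_piE;
  apply/alt_piP; [exact: AEaltl | exact: AEaltr].
Qed.

Lemma alt_in_linear : linear alt_in.
Proof.
move=> a u v; rewrite -[RHS]/(alt_add (alt_scale a (alt_in u)) (alt_in v)).
rewrite /alt_in !alt_piE.
apply/alt_piP; apply: (AEtrans (AEgenD _ _)).
exact: AEadd (AEgenZ _ _) (AErefl _).
Qed.

HB.instance Definition _ :=
  GRing.isLinear.Build F V Alt *:%R alt_in alt_in_linear.

Section Eval.
Variables (A : naAlgType F) (g : V -> A).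

Fixpoint alt_eval (t : alt_term) : A :=
  match t with
  | TGen v => g v
  | TOne => naone A
  | TZero => 0
  | TOpp s => - alt_eval s
  | TAdd s t => alt_eval s + alt_eval t
  | TScale a s => a *: alt_eval s
  | TMul s t => alt_eval s ** alt_eval t
  end.

Lemma alt_eval_eq (s t : alt_term) : alternative A -> linear g ->
  alt_eq s t -> alt_eval s = alt_eval t.
Proof.
move=> [altl altr] lg; elim=> //=.
- by move=> ? ? ? _ -> _ ->.
- by move=> ? ? _ ->.
- by move=> ? ? ? ? _ -> _ ->.
- by move=> ? ? ? _ ->.
- by move=> ? ? ? ? _ -> _ ->.
- by move=> *; rewrite addrA.
- by move=> *; rewrite addrC.
- by move=> *; rewrite add0r.
- by move=> *; rewrite addNr.
- by move=> *; rewrite scalerA.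
- by move=> *; rewrite scale1r.
- by move=> *; rewrite scalerDr.
- by move=> *; rewrite scalerDl.
- by move=> *; rewrite namulDl.
- by move=> *; rewrite namulDr.
- by move=> *; rewrite namulZl.
- by move=> *; rewrite namulZr.
- by move=> *; rewrite namul1l.
- by move=> *; rewrite namul1r.
- by move=> u v; have := lg 1 u v; rewrite !scale1r.
- move=> a u; have g0 : g 0 = 0.
    by have := lg (-1) 0 0; rewrite scaler0 addr0 scaleN1r addNr.
  by have := lg a u 0; rewrite g0 !addr0.
Qed.

End Eval.

Lemma alt_universal (A : naAlgType F) (g : V -> A) :
  alternative A -> linear g ->
  exists! f : Alt -> A, nalg_hom f /\ forall v, f (alt_in v) = g v.
Proof.
move=> altA lg.
pose f x := alt_eval g (alt_repr x).
have fE t : f (alt_pi t) = alt_eval g t.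
  by apply: alt_eval_eq => //; exact: alt_repr_pi.
exists f; split.
  split=> [|v]; last exact: (fE (TGen v)).
  split=> [a x y||x y].
  - apply: (etrans (fE (TAdd (alt_repr (alt_scale a x)) (alt_repr y)))) => /=.
    congr (_ + _); exact: (fE (TScale a (alt_repr x))).
  - exact: (fE TOne).
  - exact: (fE (TMul (alt_repr x) (alt_repr y))).
move=> h [[hl h1 hM] hg]; apply/funext => x; rewrite -[x]alt_reprK fE.
have hD y z : h (y + z) = h y + h z.
  by have := hl 1 y z; rewrite !scale1r.
have h0 : h 0 = 0.
  by have := hl (-1) 0 0; rewrite scaler0 addr0 scaleN1r addNr.
have hZ a y : h (a *: y) = a *: h y.
  by have := hl a y 0; rewrite h0 !addr0.
elim: (alt_repr x) => /=.
- by move=> v; rewrite -hg.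
- by rewrite -h1.
- by rewrite -h0.
- move=> s IHs; rewrite -alt_pi_opp -[alt_opp _]/(- alt_pi s).
  by rewrite IHs -[- alt_pi s]scaleN1r hZ scaleN1r.
- by move=> s -> t ->; rewrite -alt_pi_add -hD.
- by move=> a s ->; rewrite -alt_pi_scale -hZ.
- by move=> s -> t ->; rewrite -alt_pi_mul -hM.
Qed.

End FreeAlternative.

(* The algebra F (+) V with V V = 0, used to see that F (+) V embeds in
   Alt[V]. *)
Section SquareZero.
Variables (F : fieldType) (V : lmodType F).

Definition sqzero : Type := (F^o * V)%type.
HB.instance Definition _ := GRing.Lmodule.on sqzero.

Definition sqzero_mul (x y : sqzero) : sqzero :=
  (x.1 * y.1, x.1 *: y.2 + y.1 *: x.2).

Lemma sqzero_mulC : commutative sqzero_mul.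
Proof. by move=> x y; rewrite /sqzero_mul mulrC addrC. Qed.

Lemma sqzero_mulDl (x y z : sqzero) :
  sqzero_mul (x + y) z = sqzero_mul x z + sqzero_mul y z.
Proof.
rewrite /sqzero_mul; congr pair => /=; first by rewrite mulrDl.
by rewrite scalerDl scalerDr addrACA.
Qed.

Lemma sqzero_mulZl (a : F) (x y : sqzero) :
  sqzero_mul (a *: x) y = a *: sqzero_mul x y.
Proof.
rewrite /sqzero_mul; congr pair => /=; first by rewrite -mulrA.
by rewrite scalerDr !scalerA [y.1 * a]mulrC.
Qed.

Lemma sqzero_mulDr (x y z : sqzero) :
  sqzero_mul x (y + z) = sqzero_mul x y + sqzero_mul x z.
Proof. by rewrite sqzero_mulC sqzero_mulDl ![sqzero_mul _ x]sqzero_mulC. Qed.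

Lemma sqzero_mulZr (a : F) (x y : sqzero) :
  sqzero_mul x (a *: y) = a *: sqzero_mul x y.
Proof. by rewrite sqzero_mulC sqzero_mulZl sqzero_mulC. Qed.

Definition sqzero_one : sqzero := (1, 0).

Lemma sqzero_mul1l (x : sqzero) : sqzero_mul sqzero_one x = x.
Proof.
by case: x => a v; rewrite /sqzero_mul /= mul1r scale1r scaler0 addr0.
Qed.

Lemma sqzero_mul1r (x : sqzero) : sqzero_mul x sqzero_one = x.
Proof. by rewrite sqzero_mulC sqzero_mul1l. Qed.

HB.instance Definition _ := Lmodule_isNonassocAlgebra.Build F sqzero
  sqzero_mulDl sqzero_mulDr sqzero_mulZl sqzero_mulZr
  sqzero_mul1l sqzero_mul1r.

Lemma sqzero_mulA : associative sqzero_mul.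
Proof.
move=> x y z; rewrite /sqzero_mul; congr pair => /=; first by rewrite mulrA.
rewrite !scalerDr !scalerA addrA; congr (_ + _ + _); congr (_ *: _).
  by rewrite mulrC.
by rewrite mulrC [z.1 * _]mulrC.
Qed.

Lemma sqzero_alternative : alternative sqzero.
Proof. by split=> x y; apply: sqzero_mulA. Qed.

Lemma alt_scalar_gen_inj (a : F) (v : V) :
  a *: naone (Alt V) + alt_in v = 0 -> a = 0 /\ v = 0.
Proof.
pose g (v : V) : sqzero := (0, v).
have lg : linear g.
  by move=> b u w; congr pair; rewrite /= ?addr0 //; exact/esym/mulr0.
have [f [[[fl f1 _] fg] _]] := alt_universal sqzero_alternative lg.
move/(congr1 f); rewrite fl f1 fg.
have -> : f 0 = 0.
  by have := fl (-1) 0 0; rewrite scaler0 addr0 scaleN1r addNr.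
move=> [/= h1 h2]; move: h1 h2; rewrite addr0 scaler0 add0r => h ->.
by split=> //; rewrite -[a]mulr1.
Qed.

End SquareZero.

Section Kingdon.
Variables (F : fieldType) (V : vectType F) (B : {symmetric V}).

Definition kingdon_relators : set (Alt V) :=
  [set x | exists u v : V,
     x = alt_in u ** alt_in v + alt_in v ** alt_in u - B u v *: naone (Alt V)]
  `|`
  [set x | exists u v w : V,
     x = (alt_in u ** alt_in v) ** alt_in w
         - alt_in w ** (alt_in v ** alt_in u)].

Definition kingdon_ideal : nalg_ideal (Alt V) := gen_ideal kingdon_relators.

Definition Kingdon : naAlgType F := naquot kingdon_ideal.

Definition kingdon_in (v : V) : Kingdon := napi kingdon_ideal (alt_in v).

(* kingdon_in v is the class I_B + v, so this says that f maps I_B + v to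
   I_B - v. *)
Definition extends_negation (f : Kingdon -> Kingdon) : Prop :=
  forall v : V, f (kingdon_in v) = kingdon_in (- v).

End Kingdon.

(* Main.v *)
Require Import Defs.
From HB Require Import structures.
From mathcomp Require Import all_boot all_algebra.
From mathcomp Require Import boolp classical_sets.

Import GRing.Theory.
Local Open Scope ring_scope.

(** The Kingdon algebra is universal among alternative algebras [A] with a
    linear map [g : V -> A] satisfying the defining relations. The map
    [v |-> - v] satisfies them both in [K(V,B)] and in the opposite algebra,
    because reversing products permutes the relators up to sign. The two
    homomorphisms obtained this way are the required maps, and their squares
    are the identity because they fix [V] pointwise. *)

(** A synonym of [A], so that the same vector space can carry the reversed product. Homomorphisms
    into it are anti-homomorphisms into [A]. *)
Definition naopp {F : fieldType} (A : naAlgType F) : Type := A.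

Section Opposite.
Variables (F : fieldType) (A : naAlgType F).

HB.instance Definition _ := GRing.Lmodule.on (naopp A).

Definition naopp_mul (x y : naopp A) : naopp A := (y : A) ** (x : A).

Fact naopp_mulDl (x y z : naopp A) :
  naopp_mul (x + y) z = naopp_mul x z + naopp_mul y z.
Proof. exact: namulDr. Qed.

Fact naopp_mulDr (x y z : naopp A) :
  naopp_mul x (y + z) = naopp_mul x y + naopp_mul x z.
Proof. exact: namulDl. Qed.

Fact naopp_mulZl (a : F) (x y : naopp A) :
  naopp_mul (a *: x) y = a *: naopp_mul x y.
Proof. exact: namulZr. Qed.

Fact naopp_mulZr (a : F) (x y : naopp A) :
  naopp_mul x (a *: y) = a *: naopp_mul x y.
Proof. exact: namulZl. Qed.

Fact naopp_mul1l (x : naopp A) : naopp_mul (naone A) x = x.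
Proof. exact: namul1r. Qed.

Fact naopp_mul1r (x : naopp A) : naopp_mul x (naone A) = x.
Proof. exact: namul1l. Qed.

HB.instance Definition _ := Lmodule_isNonassocAlgebra.Build F (naopp A)
  naopp_mulDl naopp_mulDr naopp_mulZl naopp_mulZr naopp_mul1l naopp_mul1r.

(** Reversing products exchanges the left and right alternative laws. *)
Lemma naopp_alternative : alternative A -> alternative (naopp A).
Proof.
by move=> [altl altr]; split=> x y; [exact/esym/altr|exact/esym/altl].
Qed.

End Opposite.

Section Homomorphisms.
Variable F : fieldType.

Lemma nalg_hom_id (A : naAlgType F) : nalg_hom (@id A).
Proof. by []. Qed.

Lemma nalg_hom_comp (A C D : naAlgType F) (f : A -> C) (g : C -> D) :
  nalg_hom f -> nalg_hom g -> nalg_hom (g \o f).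
Proof.
move=> [fl f1 fM] [gl g1 gM]; split=> [a x y||x y] /=.
- by rewrite fl gl.
- by rewrite f1.
- by rewrite fM gM.
Qed.

(** Two reversals restore the order of products. The square of an anti-endomorphism is thus open to
    uniqueness results on homomorphisms. *)
Lemma nalg_antihom_comp (A C D : naAlgType F) (f : A -> C) (g : C -> D) :
  nalg_antihom f -> nalg_antihom g -> nalg_hom (g \o f).
Proof.
move=> [fl f1 fM] [gl g1 gM]; split=> [a x y||x y] /=.
- by rewrite fl gl.
- by rewrite f1.
- by rewrite fM gM.
Qed.

Lemma nalg_hom_ker (A C : naAlgType F) (f : A -> C) :
  nalg_hom f -> is_nalg_ideal (fun x => f x = 0).
Proof.
move=> [fl _ fM].
have mul0 (x : C) : 0 ** x = 0 by have := namulZl 0 0 x; rewrite !scale0r.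
have mulr0 (x : C) : x ** 0 = 0 by have := namulZr 0 x 0; rewrite !scale0r.
split=> [|a x y fx fy|x y fy|x y fx].
- by have := fl (-1) 0 0; rewrite scaler0 addr0 scaleN1r addNr.
- by rewrite fl fx fy scaler0 addr0.
- by rewrite fM fy mulr0.
- by rewrite fM fx mul0.
Qed.

Lemma naquot_universal (A C : naAlgType F) (I : nalg_ideal A) (f : A -> C) :
  nalg_hom f -> (forall x, I x -> f x = 0) ->
  exists2 h : naquot I -> C, nalg_hom h & forall x, h (napi I x) = f x.
Proof.
move=> [fl f1 fM] fI.
(* The chosen representative of the class of [x] differs from [x] by an element of [I], which [f]
   kills. As [linear] speaks of [a *: x + y] only, the difference is rewritten with the scalar
   [-1]. *)
have hE x : f (narepr (napi I x)) = f x.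
  have := fI _ (napi_narepr I x); rewrite addrC -scaleN1r fl scaleN1r addrC.
  by move/subr0_eq.
have [_ _ piM] := napi_hom I.
exists (fun q => f (narepr q)) => //; split=> [a p q||p q].
- by rewrite -{1}[p]nareprK -{1}[q]nareprK -napiZ -napiD hE fl.
- by rewrite hE.
- by rewrite -{1}[p]nareprK -{1}[q]nareprK -piM hE fM.
Qed.

Lemma naquot_alternative (A : naAlgType F) (I : nalg_ideal A) :
  alternative A -> alternative (naquot I).
Proof.
have [_ _ piM] := napi_hom I; move=> [altl altr].
split=> x y; rewrite -[x]nareprK -[y]nareprK -!piM !nareprK.
  by rewrite altl.
by rewrite altr.
Qed.

End Homomorphisms.

Section KingdonAlgebra.
Variables (F : fieldType) (V : vectType F) (B : {symmetric V}).

Lemma kingdon_alternative : alternative (Kingdon B).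
Proof. exact/naquot_alternative/alt_alternative. Qed.

Lemma kingdon_in_linear : linear (kingdon_in B).
Proof.
by move=> a u v; rewrite /kingdon_in alt_in_linear napiD napiZ.
Qed.

Lemma kingdon_inN (v : V) : kingdon_in B (- v) = - kingdon_in B v.
Proof.
have := kingdon_in_linear (-1) v 0; rewrite addr0 !scaleN1r => ->.
have := kingdon_in_linear (-1) 0 0.
by rewrite scaler0 addr0 scaleN1r addNr => ->; rewrite addr0.
Qed.

Lemma kingdon_in_anticomm (u v : V) :
  kingdon_in B u ** kingdon_in B v + kingdon_in B v ** kingdon_in B u =
  B u v *: naone (Kingdon B).
Proof.
have [_ pi1 piM] := napi_hom (kingdon_ideal B).
rewrite /kingdon_in -!piM -pi1 -napiZ -napiD.
by apply/napiP => J [_ JS]; apply: JS; left; exists u, v.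
Qed.

Lemma kingdon_in_reverse (u v w : V) :
  (kingdon_in B u ** kingdon_in B v) ** kingdon_in B w =
  kingdon_in B w ** (kingdon_in B v ** kingdon_in B u).
Proof.
have [_ _ piM] := napi_hom (kingdon_ideal B).
rewrite /kingdon_in -(piM (alt_in u)) -(piM (alt_in v) (alt_in u)).
rewrite -(piM (alt_in u ** alt_in v)) -(piM (alt_in w)).
by apply/napiP => J [_ JS]; apply: JS; right; exists u, v, w.
Qed.

(** The extension of [g] to [Alt V] kills both families of relators, hence factors through the
    quotient. *)
Lemma kingdon_universal (A : naAlgType F) (g : V -> A) :
  alternative A -> linear g ->
  (forall u v, g u ** g v + g v ** g u = B u v *: naone A) ->
  (forall u v w, (g u ** g v) ** g w = g w ** (g v ** g u)) ->
  exists! f : Kingdon B -> A,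
    nalg_hom f /\ forall v, f (kingdon_in B v) = g v.
Proof.
move=> altA lg gAC gR.
have [f [[fH fg] fU]] := alt_universal altA lg.
have [fl f1 fM] := fH.
have fB x y : f (x - y) = f x - f y.
  by rewrite addrC -scaleN1r fl scaleN1r addrC.
have fZ a x : f (a *: x) = a *: f x.
  have f0 : f 0 = 0 by rewrite -(subrr 0) fB subrr.
  by have := fl a x 0; rewrite f0 !addr0.
have fD x y : f (x + y) = f x + f y by rewrite -[x]scale1r fl !scale1r.
have fI x : kingdon_ideal B x -> f x = 0.
  (* Membership in the generated ideal means membership in every ideal containing the relators; the
     kernel of [f] is one of these. *)
  move=> Ix; apply: (Ix (fun x => f x = 0)); split; first exact: nalg_hom_ker.
  move=> _ [[u [v ->]]|[u [v [w ->]]]].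
    by rewrite fB fD fZ f1 !fM !fg gAC subrr.
  by rewrite fB !fM !fg gR subrr.
have [h hH hf] := naquot_universal F _ _ _ f fH fI.
exists h; split; first by split=> // v; rewrite hf.
(* Uniqueness is pulled back along the projection to uniqueness on [Alt V]. *)
move=> k [kH kg]; apply: funext => q; rewrite -[q]nareprK hf.
have /fU -> // : nalg_hom (k \o napi (kingdon_ideal B)) /\
  forall v, (k \o napi (kingdon_ideal B)) (alt_in v) = g v.
by split=> [|v]; [exact: nalg_hom_comp (napi_hom _) kH|exact: kg].
Qed.

(** Both [f] and the identity extend [kingdon_in B], so the universal property identifies them. *)
Lemma kingdon_endo_id (f : Kingdon B -> Kingdon B) :
  nalg_hom f -> (forall v, f (kingdon_in B v) = kingdon_in B v) -> f =1 id.
Proof.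
move=> fH fv.
have [h [_ hU]] := kingdon_universal _ _ kingdon_alternative
  kingdon_in_linear kingdon_in_anticomm kingdon_in_reverse.
have hf : h = f by apply: hU.
have hid : h = id by apply: hU; split=> //; exact: nalg_hom_id.
by move=> x; rewrite -hf hid.
Qed.

(** The hypothesis bears on [f \o f] so as to cover automorphisms and anti-automorphisms alike. *)
Lemma kingdon_negation_involutive (f : Kingdon B -> Kingdon B) :
  nalg_hom (f \o f) -> extends_negation f -> involutive f.
Proof.
move=> ffH fN; apply: kingdon_endo_id ffH _ => v /=.
by rewrite !fN opprK.
Qed.

Lemma kingdon_neg_linear : linear (fun v => kingdon_in B (- v)).
Proof.
by move=> a u v; rewrite opprD -scalerN kingdon_in_linear.
Qed.

(** The two signs cancel in [B] by bilinearity. *)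
Lemma kingdon_neg_anticomm (u v : V) :
  kingdon_in B (- u) ** kingdon_in B (- v) +
  kingdon_in B (- v) ** kingdon_in B (- u) = B u v *: naone (Kingdon B).
Proof. by rewrite kingdon_in_anticomm linearNl linearNr opprK. Qed.

End KingdonAlgebra.

Theorem corollary3p4 (F : fieldType) (V : vectType F) (B : {symmetric V})
    (char_neq2 : (2%:R : F) \is a GRing.unit) :
  (exists! f : Kingdon B -> Kingdon B,
     [/\ nalg_automorphism f, involutive f & extends_negation f]) /\
  (exists! f : Kingdon B -> Kingdon B,
     [/\ nalg_antiautomorphism f, involutive f & extends_negation f]).
Proof.
have KA := kingdon_alternative F V B.
have lin := kingdon_neg_linear F V B.
split.
  have [f [[fH fN] fU]] := kingdon_universal F V B _ _ KA lin
    (kingdon_neg_anticomm F V B) (fun _ _ _ => kingdon_in_reverse _ _ _ _ _ _).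
  have fI : involutive f.
    by apply: kingdon_negation_involutive => //; exact: nalg_hom_comp.
  exists f; split; first by split=> //; split=> //; exact: inv_bij.
  by move=> h [[_ hH] _ hN]; apply: fU.
(* In the opposite algebra the two summands of the anticommutation relation trade places, and the
   two sides of the reversal relation are exchanged. *)
have [f [[fH fN] fU]] := kingdon_universal F V B (naopp (Kingdon B)) _
  (naopp_alternative _ _ KA) lin
  (fun u v => etrans (addrC _ _) (kingdon_neg_anticomm F V B u v))
  (fun _ _ _ => esym (kingdon_in_reverse _ _ _ _ _ _)).
(* Unfolding the product of [naopp] turns one property into the other by conversion. *)
have fA : nalg_antihom (f : Kingdon B -> Kingdon B) := fH.
have fI : involutive f.
  by apply: kingdon_negation_involutive => //; exact: nalg_antihom_comp.
exists f; split; first by split=> //; split=> //; exact: inv_bij.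
by move=> h [[_ hH] _ hN]; apply: fU.
Qed.
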